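(* Let $(M,\varphi_i,\xi_i,\eta_i,g)$, $i=1,2,3$, be a parallel canonical almost $3$-contact metric manifold of dimension $4n+3$, $n\ge1$. Its canonical connection $\nabla$ coincides with the characteristic connection $\nabla^i$ of each of its almost contact metric structures $(\varphi_i,\xi_i,\eta_i,g)$, $i=1,2,3$. Furthermore, its holonomy algebra satisfies $\mathfrak{hol}(\nabla)\subset\mathfrak{sp}(n)$.
   Context: An almost contact metric structure $(\varphi,\xi,\eta,g)$ consists of a $(1,1)$-tensor field $\varphi$, a vector field $\xi$, a $1$-form $\eta$ and a Riemannian metric $g$ with $\varphi^2=-I+\eta\otimes\xi$, $\eta(\xi)=1$, $g(\varphi X,\varphi Y)=g(X,Y)-\eta(X)\eta(Y)$. Its fundamental form is $\Phi(X,Y)=g(X,\varphi Y)$, and $N_\varphi(X,Y)=[\varphi X,\varphi Y]+\varphi^2[X,Y]-\varphi[\varphi X,Y]-\varphi[X,\varphi Y]+d\eta(X,Y)\xi$, $N_\varphi(X,Y,Z)=g(N_\varphi(X,Y),Z)$. A metric connection has skew torsion if $T(X,Y,Z)=g(T(X,Y),Z)$ is a $3$-form. A characteristic connection of $(\varphi,\xi,\eta,g)$ is a metric connection with skew torsion such that $\nabla\eta=\nabla\varphi=0$; it is unique if it exists. An almost $3$-contact metric manifold $(M,\varphi_i,\xi_i,\eta_i,g)$, $i=1,2,3$, is a manifold of dimension $4n+3$ with three almost contact metric structures with the same $g$ such that, for every even permutation $(i,j,k)$ of $(1,2,3)$, $\varphi_k=\varphi_i\varphi_j-\eta_j\otimes\xi_i=-\varphi_j\varphi_i+\eta_i\otimes\xi_j$,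 $\xi_k=\varphi_i\xi_j=-\varphi_j\xi_i$, $\eta_k=\eta_i\circ\varphi_j=-\eta_j\circ\varphi_i$. Set $\mathcal H=\bigcap_i\ker\eta_i$ (rank $4n$); $\mathfrak{sp}(n)$ acts on $\mathcal H$ commuting with all $\varphi_i|_{\mathcal H}$, and trivially on $\langle\xi_1,\xi_2,\xi_3\rangle$. For $X,Y\in\Gamma(\mathcal H)$ let $A_{ij}(X,Y)=g((\mathcal L_{\xi_j}\varphi_i)X,Y)+d\eta_j(X,\varphi_iY)+d\eta_j(\varphi_iX,Y)$, $A_i=A_{ii}$. $M$ admits a Reeb Killing function $\beta\in C^\infty(M)$ if $A_i(X,Y)=0$ and $A_{ij}(X,Y)=-A_{ji}(X,Y)=\beta\Phi_k(X,Y)$ for all $X,Y\in\Gamma(\mathcal H)$ and every even permutation $(i,j,k)$ of $(1,2,3)$. $M$ is canonical if: 1) each $N_{\varphi_i}$ is skew-symmetric on $\mathcal H$ (i.e. $N_{\varphi_i}(X,Y,Z)$ restricted to $\mathcal H$ is a $3$-form); 2) each $\xi_i$ is Killing; 3) $N_{\varphi_i}(X,Y,Z)-d\Phi_i(\varphi_iX,\varphi_iY,\varphi_iZ)=N_{\varphi_j}(X,Y,Z)-d\Phi_j(\varphi_jX,\varphi_jY,\varphi_jZ)$ for all $X,Y,Z\in\Gamma(\mathcal H)$ and all $i,j$; 4) $M$ admits a Reeb Killing function $\beta$. It is parallel canonical if moreover $\beta=0$. The canonical connection of a canonical manifold is the unique metric connection $\nabla$ with skew torsion such that $\nabla_X\varphi_i=\beta(\eta_k(X)\varphi_j-\eta_j(X)\varphi_k)$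 for all $X$ and every even permutation $(i,j,k)$ of $(1,2,3)$, $\beta$ being the Reeb Killing function. Conventions: $d\eta(X,Y)=X(\eta(Y))-Y(\eta(X))-\eta([X,Y])$, and analogously (no numerical factors) in higher degree. *)

(* Defs.v *)
From mathcomp Require Import all_boot all_order all_algebra.
From mathcomp Require Import boolp classical_sets functions reals topology.
From mathcomp Require Import normedtype derive.

Set Implicit Arguments.
Unset Strict Implicit.
Unset Printing Implicit Defensive.
Import Order.TTheory GRing.Theory Num.Theory.
Import numFieldNormedType.Exports.
Local Open Scope classical_set_scope.
Local Open Scope ring_scope.

(* C^oo on a neighbourhood of x: at all points y near x, all the iterated
   directional derivatives of f are (Frechet) differentiable. *)
Definition smooth_near (R : realType) (V W : normedModType R)
    (f : V -> W) (x : V) : Prop :=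
  \forall y \near x, forall s : seq V,
    differentiable (foldr (fun v h => 'D_v h) f s) y.

(* [coord] and [coord_inv] are meaningful on [dom] and [coord @` dom] only. *)
Record chart (R : realType) (m : nat) (T : topologicalType) := Chart {
  dom : set T;
  coord :> T -> 'rV[R]_m;
  coord_inv : 'rV[R]_m -> T;
  dom_open : open dom;
  codom_open : open (coord @` dom);
  coordK : forall p, dom p -> coord_inv (coord p) = p;
  coord_continuous : forall p, dom p -> {for p, continuous coord};
  coord_inv_continuous : forall p, dom p ->
    {for coord p, continuous coord_inv}
}.

(* Smooth manifolds of dimension m.  Choosing a chart [chart_at p] around each
   point adds no structure: it only serves to represent the tangent space at p
   by R^m, a tangent vector at p being given by its coordinates in
   [chart_at p]. *)
Record manifold (R : realType) (m : nat) := Manifold {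
  point :> topologicalType;
  atlas : set (chart R m point);
  chart_at : point -> chart R m point;
  point_hausdorff : hausdorff_space point;
  point_second_countable : @second_countable point;
  chart_at_atlas : forall p, atlas (chart_at p);
  chart_at_dom : forall p, dom (chart_at p) p;
  atlas_smooth : forall c d : chart R m point, atlas c -> atlas d ->
    forall p, dom c p -> dom d p -> smooth_near (d \o coord_inv c) (c p)
}.

Section Manifold.
Context {R : realType} {m : nat} {M : manifold R m}.
Local Notation E := 'rV[R]_m.
Implicit Types (p q : M) (c : chart R m M) (v w : E).

(* A section of the tangent bundle, not necessarily smooth. *)
Definition vfield : Type := M -> E.
Implicit Types (X Y Z : vfield) (f : M -> R).

(* Coordinates in the chart c of the tangent vector v at q. *)
Definition tcoord c q v : E :=
  'D_v (c \o coord_inv (chart_at q)) (chart_at q q).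

(* The coordinate vector field d/dx^j of the chart c. *)
Definition coord_field c (j : 'I_m) : vfield := fun q =>
  'D_(delta_mx 0 j) (chart_at q \o coord_inv c) (c q).

Definition vfield_in c X : E -> E := fun y =>
  tcoord c (coord_inv c y) (X (coord_inv c y)).

(* Smoothness of functions and of vector fields on a neighbourhood of p. *)
Definition smooth_fun f p : Prop :=
  exists2 c, atlas c /\ dom c p & smooth_near (f \o coord_inv c) (c p).

Definition smooth_field X p : Prop :=
  exists2 c, atlas c /\ dom c p & smooth_near (vfield_in c X) (c p).

(* The derivative v(f) of f along the tangent vector v at p. *)
Definition dfun f p v : R :=
  'D_v (f \o coord_inv (chart_at p)) (chart_at p p).

Definition bracket X Y : vfield := fun p =>
  'D_(X p) (vfield_in (chart_at p) Y) (chart_at p p) -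
  'D_(Y p) (vfield_in (chart_at p) X) (chart_at p p).

Definition ap (F : M -> E -> E) X : vfield := fun p => F p (X p).

Definition lie_endo (xi : vfield) (F : M -> E -> E) X : vfield := fun p =>
  bracket xi (ap F X) p - F p (bracket xi X p).

Definition d1 (eta : M -> E -> R) X Y p : R :=
  dfun (fun q => eta q (Y q)) p (X p)
  - dfun (fun q => eta q (X q)) p (Y p)
  - eta p (bracket X Y p).

Definition d2 (Om : M -> E -> E -> R) X Y Z p : R :=
  dfun (fun q => Om q (Y q) (Z q)) p (X p)
  - dfun (fun q => Om q (X q) (Z q)) p (Y p)
  + dfun (fun q => Om q (X q) (Y q)) p (Z p)
  - Om p (bracket X Y p) (Z p)
  + Om p (bracket X Z p) (Y p)
  - Om p (bracket Y Z p) (X p).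

(* For a tensorial t, this says that t restricts at p to a 3-form on the vector
   fields satisfying P. *)
Definition alternating (P : vfield -> Prop)
    (t : vfield -> vfield -> vfield -> M -> R) p : Prop :=
  forall X Y Z, P X -> P Y -> P Z ->
    t X Y Z p = - t Y X Z p /\ t X Y Z p = - t X Z Y p.

End Manifold.
Arguments vfield {R m} M.

Record metric (R : realType) (m : nat) (M : manifold R m) := Metric {
  metric_fun :> M -> 'rV[R]_m -> 'rV[R]_m -> R;
  metric_linear : forall p a u v w,
    metric_fun p (a *: u + v) w = a * metric_fun p u w + metric_fun p v w;
  metric_sym : forall p v w, metric_fun p v w = metric_fun p w v;
  metric_posdef : forall p v, v != 0 -> 0 < metric_fun p v v;
  metric_smooth : forall (X Y : vfield M) p,
    smooth_field X p -> smooth_field Y p ->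
    smooth_fun (fun q => metric_fun q (X q) (Y q)) p
}.

(* Almost contact metric structures. *)
Record acm (R : realType) (m : nat) (M : manifold R m) (g : metric M) := Acm {
  phi : M -> {linear 'rV[R]_m -> 'rV[R]_m};
  xi : vfield M;
  eta : M -> {scalar 'rV[R]_m};
  phi_smooth : forall (X : vfield M) p,
    smooth_field X p -> smooth_field (ap phi X) p;
  xi_smooth : forall p, smooth_field xi p;
  eta_smooth : forall (X : vfield M) p,
    smooth_field X p -> smooth_fun (fun q => eta q (X q)) p;
  phi_sqr : forall p v, phi p (phi p v) = - v + eta p v *: xi p;
  eta_xi : forall p, eta p (xi p) = 1;
  phi_metric : forall p v w,
    g p (phi p v) (phi p w) = g p v w - eta p v * eta p w
}.

Section AlmostContact.
Context {R : realType} {m : nat} {M : manifold R m} {g : metric M}.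
Implicit Types (s : acm g) (X Y Z : vfield M) (p : M).

Definition Phi s : M -> 'rV[R]_m -> 'rV[R]_m -> R :=
  fun p v w => g p v (phi s p w).

Definition nijenhuis s X Y : vfield M := fun p =>
  let F := phi s in
  bracket (ap F X) (ap F Y) p + F p (F p (bracket X Y p))
  - F p (bracket (ap F X) Y p) - F p (bracket X (ap F Y) p)
  + d1 (eta s) X Y p *: xi s p.

Definition nijenhuis3 s X Y Z p : R := g p (nijenhuis s X Y p) (Z p).

End AlmostContact.

Definition killing (R : realType) (m : nat) (M : manifold R m) (g : metric M)
    (xi : vfield M) : Prop :=
  forall p (X Y : vfield M), smooth_field X p -> smooth_field Y p ->
    dfun (fun q => g q (X q) (Y q)) p (xi p) =
    g p (bracket xi X p) (Y p) + g p (X p) (bracket xi Y p).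

(* Almost 3-contact metric structures on a manifold of dimension 4n+3.  The
   three structures are indexed by Z/3: the even permutations (i,j,k) of the
   indices are the triples (i, i+1, i+2). *)
Record acm3 (R : realType) (n : nat) (M : manifold R (4 * n + 3)) (g : metric M)
    := Acm3 {
  structure :> 'Z_3 -> acm g;
  acm3_phi : forall (i : 'Z_3) p v, let j := i + 1 in let k := i + 2 in
    phi (structure k) p v =
      phi (structure i) p (phi (structure j) p v)
      - eta (structure j) p v *: xi (structure i) p
    /\ phi (structure k) p v =
      - phi (structure j) p (phi (structure i) p v)
      + eta (structure i) p v *: xi (structure j) p;
  acm3_xi : forall (i : 'Z_3) p, let j := i + 1 in let k := i + 2 in
    xi (structure k) p = phi (structure i) p (xi (structure j) p)
    /\ xi (structure k) p = - phi (structure j) p (xi (structure i) p);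
  acm3_eta : forall (i : 'Z_3) p v, let j := i + 1 in let k := i + 2 in
    eta (structure k) p v = eta (structure i) p (phi (structure j) p v)
    /\ eta (structure k) p v = - eta (structure j) p (phi (structure i) p v)
}.

Section Canonical.
Context {R : realType} {n : nat} {M : manifold R (4 * n + 3)} {g : metric M}.
Variable S : acm3 g.
Implicit Types (X Y Z : vfield M) (p : M) (i j : 'Z_3).

Definition horizontal p (v : 'rV[R]_(4 * n + 3)) : Prop :=
  forall i, eta (S i) p v = 0.

(* Smooth sections of the horizontal distribution defined near p. *)
Definition hfield p X : Prop :=
  smooth_field X p /\ \forall q \near p, horizontal q (X q).

Definition A_ i j X Y p : R :=
  g p (lie_endo (xi (S j)) (phi (S i)) X p) (Y p)
  + d1 (eta (S j)) X (ap (phi (S i)) Y) p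
  + d1 (eta (S j)) (ap (phi (S i)) X) Y p.

Definition reeb_killing (beta : M -> R) : Prop :=
  (forall p, smooth_fun beta p) /\
  forall p X Y, hfield p X -> hfield p Y -> forall i,
    let j := i + 1 in let k := i + 2 in
    [/\ A_ i i X Y p = 0,
        A_ i j X Y p = beta p * Phi (S k) p (X p) (Y p) &
        - A_ j i X Y p = beta p * Phi (S k) p (X p) (Y p)].

(* (M, S) is canonical with Reeb Killing function beta. *)
Definition canonical (beta : M -> R) : Prop :=
  [/\ forall i p, alternating (hfield p) (nijenhuis3 (S i)) p,
      forall i, killing g (xi (S i)),
      forall i j p X Y Z, hfield p X -> hfield p Y -> hfield p Z ->
        let D s := nijenhuis3 s X Y Z p
          - d2 (Phi s) (ap (phi s) X) (ap (phi s) Y) (ap (phi s) Z) p in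
        D (S i) = D (S j)
    & reeb_killing beta].

Definition parallel_canonical (beta : M -> R) : Prop :=
  canonical beta /\ forall p, beta p = 0.

End Canonical.

(* Covariant derivatives of vector fields defined near a point; the value at
   p depends only on Y near p, since [conn_leibniz] applies to functions f
   that are constant near p.  A connection on global vector fields extends
   uniquely to such local ones. *)
Record connection (R : realType) (m : nat) (M : manifold R m) := Connection {
  nabla :> forall p : M, 'rV[R]_m -> vfield M -> 'rV[R]_m;
  conn_linear : forall p a v w Y, smooth_field Y p ->
    nabla p (a *: v + w) Y = a *: nabla p v Y + nabla p w Y;
  conn_additive : forall p v X Y, smooth_field X p -> smooth_field Y p ->
    nabla p v (fun q => X q + Y q) = nabla p v X + nabla p v Y;
  conn_leibniz : forall p v f Y, smooth_fun f p -> smooth_field Y p ->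
    nabla p v (fun q => f q *: Y q) = f p *: nabla p v Y + dfun f p v *: Y p;
  conn_smooth : forall p X Y, smooth_field X p -> smooth_field Y p ->
    smooth_field (fun q => nabla q (X q) Y) p
}.

Section Connection.
Context {R : realType} {m : nat} {M : manifold R m}.
Implicit Types (g : metric M) (D : connection M) (X Y Z : vfield M) (p : M).
Local Notation E := 'rV[R]_m.

(* Equality of covariant derivatives of smooth vector fields; the values on
   non-smooth ones are irrelevant. *)
Definition conn_eq D D' : Prop :=
  forall p v Y, smooth_field Y p -> D p v Y = D' p v Y.

Definition nabla_endo D (F : M -> E -> E) p v Y : E :=
  D p v (ap F Y) - F p (D p v Y).

Definition nabla_form D (eta : M -> E -> R) p v Y : R :=
  dfun (fun q => eta q (Y q)) p v - eta p (D p v Y).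

Definition metric_connection g D : Prop :=
  forall p v X Y, smooth_field X p -> smooth_field Y p ->
    dfun (fun q => g q (X q) (Y q)) p v =
    g p (D p v X) (Y p) + g p (X p) (D p v Y).

Definition torsion D X Y : vfield M := fun p =>
  D p (X p) Y - D p (Y p) X - bracket X Y p.

Definition skew_torsion g D : Prop := forall p,
  alternating (fun X => smooth_field X p)
    (fun X Y Z q => g q (torsion D X Y q) (Z q)) p.

Definition characteristic_connection g (s : acm g) D : Prop :=
  [/\ metric_connection g D,
      skew_torsion g D,
      forall p v Y, smooth_field Y p -> nabla_form D (eta s) p v Y = 0 &
      forall p v Y, smooth_field Y p -> nabla_endo D (phi s) p v Y = 0].

(* Smooth paths [0, 1] -> M are restrictions of paths that are smooth on a
   neighbourhood of [0, 1]. *)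
Definition smooth_path (gam : R -> M) : Prop :=
  forall t : R, 0 <= t <= 1 ->
    exists2 c, atlas c /\ (\forall u \near t, dom c (gam u))
             & smooth_near (c \o gam) t.

Definition velocity (gam : R -> M) (t : R) : E :=
  derive1 (chart_at (gam t) \o gam) t.

(* The coordinates, in the chart chosen at [gam t], of a vector field V along
   gam (V u is a tangent vector at [gam u]). *)
Definition along_in (gam : R -> M) (V : R -> E) (t : R) : R -> E :=
  fun u => tcoord (chart_at (gam t)) (gam u) (V u).

(* D_t V = sum_j (dV^j/dt) d_j + V^j nabla_(gam'(t)) d_j, where the d_j are the
   coordinate vector fields of the chart chosen at [gam t]. *)
Definition cov_along D (gam : R -> M) (V : R -> E) (t : R) : E :=
  derive1 (along_in gam V t) t
  + \sum_j V t 0 j *: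
      D (gam t) (velocity gam t) (coord_field (chart_at (gam t)) j).

Definition parallel D (gam : R -> M) (V : R -> E) : Prop :=
  forall t : R, 0 <= t <= 1 ->
    derivable (along_in gam V t) t 1 /\ cov_along D gam V t = 0.

(* The matrix P, acting on row vectors on the right, represents the parallel
   transport along gam from [gam 0] to [gam 1]. *)
Definition parallel_transport D (gam : R -> M) (P : 'M[R]_m) : Prop :=
  forall v, exists V : R -> E,
    [/\ V 0 = v, V 1 = v *m P & parallel D gam V].

(* Parallel transport along piecewise smooth paths from p to q, that is, along
   finite concatenations of smooth paths. *)
Inductive pw_transport D : M -> M -> 'M[R]_m -> Prop :=
| pw_transport_nil p : pw_transport D p p 1%:M
| pw_transport_cons gam q P Q :
    smooth_path gam -> parallel_transport D gam P ->
    pw_transport D (gam 1) q Q -> pw_transport D (gam 0) q (P *m Q).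

Definition holonomy_group D p : set 'M[R]_m := [set P | pw_transport D p p P].

(* The Lie algebra of the (immersed) Lie subgroup Hol_p of GL(T_p M): the
   initial velocities of the smooth curves in Hol_p starting at the identity. *)
Definition holonomy_algebra D p : set 'M[R]_m := [set A |
  exists c : R -> 'M[R]_m,
    [/\ smooth_near c 0, \forall t \near 0, holonomy_group D p (c t),
        c 0 = 1%:M & derive1 c 0 = A]].

End Connection.

Section Canonical3.
Context {R : realType} {n : nat} {M : manifold R (4 * n + 3)} {g : metric M}.
Variable S : acm3 g.

(* D is the canonical connection of the canonical manifold (M, S) with Reeb
   Killing function beta. *)
Definition canonical_connection (beta : M -> R) (D : connection M) : Prop :=
  [/\ metric_connection g D,
      skew_torsion g D &
      forall p v Y, smooth_field Y p -> forall i : 'Z_3,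
        let j := i + 1 in let k := i + 2 in
        nabla_endo D (phi (S i)) p v Y =
        beta p *: (eta (S k) p v *: phi (S j) p (Y p)
                   - eta (S j) p v *: phi (S k) p (Y p))].

(* sp(n) inside so(T_p M): the skew-symmetric endomorphisms that vanish on the
   Reeb vectors and act on the horizontal space, a quaternionic vector space
   of dimension n, as skew-Hermitian quaternionic-linear endomorphisms. *)
Definition sp (p : M) : set 'M[R]_(4 * n + 3) := [set A |
  [/\ forall v w, g p (v *m A) w = - g p v (w *m A),
      forall i : 'Z_3, xi (S i) p *m A = 0,
      forall v, horizontal S p v -> horizontal S p (v *m A) &
      forall (i : 'Z_3) v, horizontal S p v ->
        phi (S i) p (v *m A) = phi (S i) p v *m A]].

End Canonical3.

(* Main.v *)
(* With beta = 0 the canonical connection satisfies nabla phi_i = 0, hence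
   phi_i (nabla xi_i) = 0, and |xi_i| = 1 then gives nabla xi_i = 0 and
   nabla eta_i = 0.  Two characteristic connections of (phi, xi, eta, g) differ
   by a 3-form A with A(xi, ., .) = 0 such that moving phi from one slot of A to
   another changes the sign; going around the three slots gives
   A(phi X, Y, Z) = - A(phi X, Y, Z), so A = 0.  Finally the bilinear forms g
   and Phi_i are nabla-parallel, so they are constant along pairs of parallel
   fields and invariant under the holonomy group; differentiating, an element A
   of the holonomy algebra is skew-symmetric and commutes with phi_i.  Then
   phi_i (A xi_i) = 0 and A xi_i is orthogonal to xi_i, so A xi_i = 0. *)
Require Import Defs.
From mathcomp Require Import all_boot all_order all_algebra.
From mathcomp Require Import boolp classical_sets functions reals topology.
From mathcomp Require Import normedtype derive.
From mathcomp Require Import landau ring lra.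

Set Implicit Arguments.
Unset Strict Implicit.
Unset Printing Implicit Defensive.
Import Order.TTheory GRing.Theory Num.Theory.
Import numFieldNormedType.Exports.

(** * Locality of differentiability and smoothness *)

Section SmoothNear.
Local Open Scope ring_scope.
Local Open Scope classical_set_scope.
Context {R : realType} {V W : normedModType R}.

Lemma smooth_near_differentiable (f : V -> W) x :
  smooth_near f x -> differentiable f x.
Proof. by move=> /nbhs_singleton /(_ [::]). Qed.

(** The first-order expansion of [f] at [x] is also one of [h], and the differential is determined
    by such an expansion. *)
Lemma near_eq_differentiable (f h : V -> W) x :
  (\near x, f x = h x) -> differentiable f x -> differentiable h x.
Proof.
move=> fh df; have [dfc /eqaddoP fo] := (diff_locallyP x f).1 df.
have ho : h \o shift x = cst (h x) + 'd f x +o_ 0 id.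
  apply/eqaddoP => e e0; move: (fo e e0).
  have : \forall y \near (0 : V), f (y + x) = h (y + x).
    by move: fh; rewrite (near_shift 0) /=; apply: filterS => y; rewrite subr0.
  apply: filterS2 => y fhy.
  by rewrite -(nbhs_singleton fh) !fctE /= fhy.
apply/diff_locallyP.
by have -> : 'd h x = 'd f x :> (V -> W) by exact: diff_unique.
Qed.

Lemma near_cst_smooth (f : V -> W) x a :
  (\forall y \near x, f y = a) -> smooth_near f x.
Proof.
move=> /near_join; apply: filterS => y fa s.
(* By induction on the list of directions, every iterated derivative is constant near [y]: equal to
   [a] for the empty list, to 0 otherwise. *)
have {fa} [b fb] : exists b, \forall z \near y,
    foldr (fun v h => 'D_v h) f s z = b.
  elim: s => [|v s [b fb]] /=; first by exists a.
  exists 0; move/near_join: fb; apply: filterS => z fz.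
  by rewrite -[RHS](derive_cst b z v); exact: near_eq_derive.
apply: (near_eq_differentiable _ (differentiable_cst b y)).
by move: fb; apply: filterS => z ->.
Qed.

End SmoothNear.

(** * Changes of charts and coordinate frames *)

Section Charts.
Local Open Scope ring_scope.
Local Open Scope classical_set_scope.
Context {R : realType} {m : nat} {M : manifold R m}.
Local Notation E := 'rV[R]_m.
Implicit Types (c d : chart R m M) (p q : M).

Lemma near_dom c p : dom c p -> \forall q \near p, dom c q.
Proof. by move=> cp; apply: open_nbhs_nbhs; split=> //; exact: dom_open. Qed.

Lemma near_coord_inv c p (P : set M) : dom c p -> nbhs p P ->
  \forall y \near c p, (c @` dom c) y /\ P (coord_inv c y).
Proof.
move=> cp nP; near=> y; split; near: y.
  by apply: open_nbhs_nbhs; split; [exact: codom_open|exists p].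
apply: (coord_inv_continuous cp); by rewrite /= coordK.
Unshelve. all: by end_near. Qed.

Lemma differentiable_transition c d p : atlas c -> atlas d -> dom c p ->
  dom d p -> differentiable (d \o coord_inv c) (c p).
Proof.
by move=> *; apply: smooth_near_differentiable; exact: (atlas_smooth (m := m)).
Qed.

(** The two transition maps are mutually inverse near [c p], so by the chain rule their
    differentials compose to the identity. *)
Lemma transitionK c d p (v : E) : atlas c -> atlas d -> dom c p -> dom d p ->
  'D_('D_v (d \o coord_inv c) (c p)) (c \o coord_inv d) (d p) = v.
Proof.
move=> ac ad cp dp.
have dcd := differentiable_transition ac ad cp dp.
have ddc := differentiable_transition ad ac dp cp.
have cE : d p = (d \o coord_inv c) (c p) by rewrite /= coordK.
rewrite cE in ddc *.
have E1 := diff_comp dcd ddc.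
rewrite (deriveE _ dcd) (deriveE _ ddc) -[LHS]/(('d _ _ \o 'd _ _) v) -E1.
rewrite -deriveE; last exact: differentiable_comp.
rewrite -[RHS](@derive_id _ _ (c p) v); apply: near_eq_derive.
have := near_coord_inv cp (near_dom dp).
apply: filterS => y [[q cq <-]]; rewrite coordK// => dq.
by rewrite /comp !coordK.
Qed.

(* [coord_field c j] is [frame c (delta_mx 0 j)]. *)
Definition frame c v : vfield M := fun q =>
  'D_v (chart_at q \o coord_inv c) (c q).

Lemma frame_tcoord c q v : atlas c -> dom c q -> frame c (tcoord c q v) q = v.
Proof.
move=> ac cq; apply: transitionK => //; first exact: chart_at_atlas.
exact: chart_at_dom.
Qed.

Lemma tcoord_frame c q v : atlas c -> dom c q -> tcoord c q (frame c v q) = v.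
Proof.
move=> ac cq; apply: transitionK => //; first exact: chart_at_atlas.
exact: chart_at_dom.
Qed.

Lemma tcoord_chart_at p v : tcoord (chart_at p) p v = v.
Proof.
rewrite /tcoord -[RHS](@derive_id _ _ (chart_at p p) v); apply: near_eq_derive.
have := near_coord_inv (chart_at_dom p) (near_dom (chart_at_dom p)).
apply: filterS => y [[q cq <-]]; rewrite coordK// => dq.
by rewrite /comp !coordK.
Qed.

Lemma frame_chart_at p v : frame (chart_at p) v p = v.
Proof. exact: tcoord_chart_at. Qed.

(** Read in the chart [c] itself, this field is the constant [v]. *)
Lemma smooth_frame c v p : atlas c -> dom c p -> smooth_field (frame c v) p.
Proof.
move=> ac cp; exists c => //; apply: (@near_cst_smooth _ _ _ _ _ v).
have := near_coord_inv cp (near_dom cp); apply: filterS => y [_ cy].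
exact: tcoord_frame.
Qed.

Lemma exists_smooth_field p v :
  exists2 X : vfield M, smooth_field X p & X p = v.
Proof.
exists (frame (chart_at p) v); last exact: frame_chart_at.
by apply: smooth_frame; [exact: chart_at_atlas|exact: chart_at_dom].
Qed.

Lemma frame_sum c v p : atlas c -> dom c p ->
  frame c v p = \sum_j v 0 j *: coord_field c j p.
Proof.
move=> ac cp; have dc := differentiable_transition ac (chart_at_atlas p) cp
  (chart_at_dom p).
rewrite /frame deriveE// {1}(row_sum_delta v) linear_sum; apply: eq_bigr => j _.
by rewrite linearZ /coord_field deriveE.
Qed.

End Charts.

(** * Derivatives along paths *)

Section Paths.
Local Open Scope ring_scope.
Local Open Scope classical_set_scope.
Context {R : realType} {m : nat} {M : manifold R m}.
Local Notation E := 'rV[R]_m.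
Implicit Types (c : chart R m M) (p q : M) (f : M -> R) (gam : R -> M).

(** Smoothness of [f] provides one chart only; composing with a transition map reaches every chart
    of the atlas around [p]. *)
Lemma smooth_fun_differentiable f c p : smooth_fun f p -> atlas c -> dom c p ->
  differentiable (f \o coord_inv c) (c p).
Proof.
move=> [d [ad dp] /smooth_near_differentiable df] ac cp.
have dcd := differentiable_transition ac ad cp dp.
apply: (@near_eq_differentiable _ _ _
  ((f \o coord_inv d) \o (d \o coord_inv c))).
  have := near_coord_inv cp (near_dom dp).
  by apply: filterS => y [_ dy]; rewrite /comp coordK.
by apply: differentiable_comp => //; rewrite /comp coordK.
Qed.

Lemma smooth_path_continuous gam t : smooth_path gam -> 0 <= t <= 1 ->
  {for t, continuous gam}.
Proof.
move=> sg /sg [c [ac cg] /smooth_near_differentiable dg] P nP.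
have := differentiable_continuous dg (near_coord_inv (nbhs_singleton cg) nP).
rewrite -[nbhs _ _]/(nbhs t _) -[nbhs _ P]/(nbhs t _).
by apply: filterS2 cg => u cu [_]; rewrite /comp coordK.
Qed.

Lemma differentiable_path gam c t : smooth_path gam -> 0 <= t <= 1 ->
  atlas c -> dom c (gam t) -> differentiable (c \o gam) t.
Proof.
move=> sg t01 ac ct.
have [d [ad dg] /smooth_near_differentiable dd] := sg t t01.
have dt := nbhs_singleton dg.
have ddc := differentiable_transition ad ac dt ct.
apply: (@near_eq_differentiable _ _ _ ((c \o coord_inv d) \o (d \o gam))).
  by apply: filterS dg => u du; rewrite /comp coordK.
exact: differentiable_comp.
Qed.

(** This is the chain rule read in the chart chosen at [gam t], whose domain contains [gam u] for
    [u] near [t] by continuity. *)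
Lemma is_derive_along_path gam f t : smooth_path gam -> 0 <= t <= 1 ->
  smooth_fun f (gam t) ->
  is_derive t 1 (f \o gam) (dfun f (gam t) (velocity gam t)).
Proof.
move=> sg t01 sf; set c := chart_at (gam t).
have ac : atlas c by exact: chart_at_atlas.
have ct : dom c (gam t) by exact: chart_at_dom.
have dg := differentiable_path sg t01 ac ct.
have df := smooth_fun_differentiable sf ac ct.
apply: (@near_eq_is_derive _ _ _ ((f \o coord_inv c) \o (c \o gam))).
  have : \forall u \near t, dom c (gam u).
    exact: (smooth_path_continuous sg t01 (near_dom ct)).
  by apply: filterS => u cu; rewrite /comp coordK.
rewrite /dfun /velocity -/c derive1E' // (deriveE _ df).
have -> : 'd (f \o coord_inv c) (c (gam t)) ('d (c \o gam) t 1) =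
  ('d (f \o coord_inv c) ((c \o gam) t) \o 'd (c \o gam) t) 1 by [].
rewrite -(diff_comp dg df) -deriveE; last exact: differentiable_comp.
by apply/derivableP/diff_derivable/differentiable_comp.
Qed.

(** Product rule for a bilinear form in coordinates: [a] and [b] are components of vectors, [G] is
    the matrix of the form. It serves along a path, where [G] varies, and along a curve of
    holonomies, where [G] is constant. *)
Lemma is_derive_bilinear_combination n (a b : 'I_n -> R -> R)
    (G : 'I_n -> 'I_n -> R -> R) (da db : 'I_n -> R)
    (dG : 'I_n -> 'I_n -> R) (t : R) :
  (forall i, is_derive t 1 (a i) (da i)) ->
  (forall i, is_derive t 1 (b i) (db i)) ->
  (forall i j, is_derive t 1 (G i j) (dG i j)) ->
  is_derive t 1 (fun u => \sum_i \sum_j a i u * b j u * G i j u)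
    (\sum_i \sum_j (da i * b j t * G i j t + a i t * db j * G i j t
      + a i t * b j t * dG i j)).
Proof.
move=> ha hb hG.
have -> : (fun u => \sum_i \sum_j a i u * b j u * G i j u) =
    \sum_i \sum_j (a i * b j * G i j).
  apply/funext => u; rewrite fct_sumE; apply: eq_bigr => i _.
  by rewrite fct_sumE.
apply: is_derive_sum => i; apply: is_derive_sum => j.
apply: is_derive_eq; rewrite /GRing.scale /=.
rewrite !fctE; ring.
Qed.

End Paths.

(** * Parallel bilinear forms and their invariance under holonomy *)

Section ParallelForms.
Local Open Scope ring_scope.
Local Open Scope classical_set_scope.

Lemma scalar_sum (R : pzRingType) (V : lmodType R) (f : V -> R) (I : Type)
    (r : seq I) (a : I -> R) (u : I -> V) :
  scalar f -> f (\sum_(i <- r) a i *: u i) = \sum_(i <- r) a i * f (u i).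
Proof.
move=> lf; have f0 : f 0 = 0.
  by have := lf (-1) 0 0; rewrite scaler0 addr0 mulN1r addNr.
elim: r => [|i r IH]; first by rewrite !big_nil.
by rewrite !big_cons lf IH.
Qed.

Lemma bilinear_sum (R : comPzRingType) (V : lmodType R) (B : V -> V -> R)
    (n : nat) (a b : 'I_n -> R) (u w : 'I_n -> V) :
  (forall w, scalar (B ^~ w)) -> (forall v, scalar (B v)) ->
  B (\sum_i a i *: u i) (\sum_i b i *: w i) =
  \sum_i \sum_j a i * b j * B (u i) (w j).
Proof.
move=> lB rB; rewrite (scalar_sum _ _ _ (lB _)); apply: eq_bigr => i _.
rewrite (scalar_sum _ _ _ (rB _)) mulr_sumr; apply: eq_bigr => j _.
by rewrite mulrA.
Qed.

Context {R : realType} {m : nat} {M : manifold R m}.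
Local Notation E := 'rV[R]_m.
Implicit Types (p q : M) (D : connection M) (B : M -> E -> E -> R).

(** The last equation is nabla B = 0. The notion is stated for bilinear forms in general so as to
    cover both [g] and [Phi]. *)
Definition parallel_form D B : Prop :=
  [/\ forall p w, scalar (B p ^~ w), forall p v, scalar (B p v) &
      forall p X Y, smooth_field X p -> smooth_field Y p ->
        smooth_fun (fun q => B q (X q) (Y q)) p /\
        forall v, dfun (fun q => B q (X q) (Y q)) p v =
          B p (D p v X) (Y p) + B p (X p) (D p v Y)].

(** The derivative is B(D_t V, W) + B(V, D_t W) = 0. Since [V] and [W] live only along the path,
    they are expanded in the coordinate fields of the chart at [gam t], and nabla B = 0 is applied
    to these fields. *)
Lemma parallel_form_is_derive0 D B gam (V W : R -> E) (t : R) :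
  parallel_form D B ->
  smooth_path gam -> parallel D gam V -> parallel D gam W -> 0 <= t <= 1 ->
  is_derive t 1 (fun u => B (gam u) (V u) (W u)) 0.
Proof.
move=> [lB rB dB] sg /[swap] pW /[swap] t01 /(_ t t01) [dV cV].
have [{}dW cW] := pW t t01.
set p := gam t; set c := chart_at p.
have ac : atlas c by exact: chart_at_atlas.
have cp : dom c p by exact: chart_at_dom.
have scf j : smooth_field (coord_field c j) p by exact: smooth_frame.
have cfE j : coord_field c j p = delta_mx 0 j by exact: frame_chart_at.
have alongE U : along_in gam U t t = U t by exact: tcoord_chart_at.
have near_expand U : \forall u \near t,
    U u = \sum_j along_in gam U t u 0 j *: coord_field c j (gam u).
  have : \forall u \near t, dom c (gam u).
    exact: (smooth_path_continuous sg t01 (near_dom cp)).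
  apply: filterS => u cu; rewrite -frame_sum//.
  by rewrite /along_in -/p -/c frame_tcoord.
pose G i j (q : M) := B q (coord_field c i q) (coord_field c j q).
have dG i j : is_derive t 1 (G i j \o gam) (dfun (G i j) p (velocity gam t)).
  by apply: is_derive_along_path => //; have [] := dB p _ _ (scf i) (scf j).
have dcoef U (dU : derivable (along_in gam U t) t 1) i :
    is_derive t 1 (fun u => along_in gam U t u 0 i)
                  (derive1 (along_in gam U t) t 0 i).
  rewrite derive1E (derive_mx dU) mxE; apply/derivableP.
  by have := (derivable_mxP _ _ _).1 dU 0 i.
have := is_derive_bilinear_combination (dcoef V dV) (dcoef W dW) dG.
set F := (X in is_derive _ _ X _) => dF.
apply: (@near_eq_is_derive _ _ _ F).
  apply: filterS2 (near_expand V) (near_expand W) => u Vu Wu.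
  by rewrite [in RHS]Vu [in RHS]Wu bilinear_sum.
apply: is_derive_eq dF _.
set v := velocity gam t in dG cV cW *.
have expand (u : E) : u = \sum_j u 0 j *: coord_field c j p.
  by rewrite {1}(row_sum_delta u); apply: eq_bigr => j _; rewrite cfE.
have Bcov (dU U : E) w : B p (dU + \sum_j U 0 j *: D p v (coord_field c j)) w =
  \sum_i \sum_j (dU 0 i * w 0 j * G i j p + U 0 i * w 0 j *
      B p (D p v (coord_field c i)) (coord_field c j p)).
  have -> : dU + \sum_j U 0 j *: D p v (coord_field c j) =
    1 *: dU + \sum_j U 0 j *: D p v (coord_field c j) by rewrite scale1r.
  rewrite lB mul1r {1}(expand dU) {1 2}(expand w) !bilinear_sum// -big_split.
  by apply: eq_bigr => i _; rewrite -big_split.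
have Bcov' (dU U : E) w : B p w (dU + \sum_j U 0 j *: D p v (coord_field c j)) =
  \sum_i \sum_j (w 0 i * dU 0 j * G i j p + w 0 i * U 0 j *
      B p (coord_field c i p) (D p v (coord_field c j))).
  have -> : dU + \sum_j U 0 j *: D p v (coord_field c j) =
    1 *: dU + \sum_j U 0 j *: D p v (coord_field c j) by rewrite scale1r.
  rewrite rB mul1r {1}(expand dU) {1 2}(expand w) !bilinear_sum// -big_split.
  by apply: eq_bigr => i _; rewrite -big_split.
have B0 w : B p 0 w = 0.
  by have := lB p w (-1) 0 0; rewrite scaler0 addr0 mulN1r addNr.
have B0' w : B p w 0 = 0.
  by have := rB p w (-1) 0 0; rewrite scaler0 addr0 mulN1r addNr.
(* The number 0 is rewritten as B(D_t V, W) + B(V, D_t W), both expanded in the frame, and compared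
   term by term with the derivative of [F]. *)
have := congr1 (B p ^~ (W t)) cV; rewrite /= B0 /cov_along Bcov => eV.
have := congr1 (B p (V t)) cW; rewrite /= B0' /cov_along Bcov' => eW.
rewrite -[RHS]addr0 -[X in _ = X + _]eV -[X in _ = _ + X]eW -big_split /=.
apply: eq_bigr => i _; rewrite -big_split /=; apply: eq_bigr => j _.
have [_ ->] := dB p _ _ (scf i) (scf j).
by rewrite !alongE; ring.
Qed.

(** The derivative vanishes on [0, 1], so the mean value theorem applies. *)
Lemma parallel_form_path D B gam (V W : R -> E) : parallel_form D B ->
  smooth_path gam -> parallel D gam V -> parallel D gam W ->
  B (gam 1) (V 1) (W 1) = B (gam 0) (V 0) (W 0).
Proof.
move=> pB sg pV pW; set f := fun u => B (gam u) (V u) (W u).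
have df (t : R) : 0 <= t <= 1 -> is_derive t 1 f 0.
  exact: (parallel_form_is_derive0 pB sg pV pW).
have [| |c _] := @MVT_segment R f (fun=> 0) 0 1 ler01.
- by move=> x; rewrite in_itv /= => /andP[x0 x1]; apply: df; rewrite !ltW.
- apply: derivable_within_continuous => x; rewrite in_itv /= => x01.
  by have [] := df x x01.
- by rewrite mul0r => /eqP; rewrite subr_eq0 => /eqP.
Qed.

(** Induction on the pieces of the path: any two vectors extend to parallel fields along the first
    piece, so its transport preserves [B]. *)
Lemma pw_transport_form D B p q P v w : parallel_form D B ->
  pw_transport D p q P -> B q (v *m P) (w *m P) = B p v w.
Proof.
move=> pB pP; elim: pP v w => [{}p v w|gam {}q {}P Q sg tP _ IH v w].
  by rewrite !mulmx1.
rewrite !mulmxA IH; have [V [V0 V1 pV]] := tP v; have [W [W0 W1 pW]] := tP w.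
by rewrite -V1 -W1 (parallel_form_path pB sg pV pW) V0 W0.
Qed.

(** For a curve [c] of holonomies with c(0) = 1 and c'(0) = A, the function B(v c(t), w c(t)) is
    constant near 0; its derivative at 0 is the left-hand side. *)
Lemma holonomy_algebra_form D B p A v w : parallel_form D B ->
  holonomy_algebra D p A -> B p (v *m A) w + B p v (w *m A) = 0.
Proof.
move=> pB [c [/smooth_near_differentiable sc hc c0 <-]].
have [lB rB _] := pB.
have dc : derivable c 0 1 by exact: diff_derivable.
have dmul (x : E) i : is_derive (0 : R) 1 (fun t => (x *m c t) 0 i)
    ((x *m derive1 c 0) 0 i).
  have -> : (fun t => (x *m c t) 0 i) = \sum_k (x 0 k *: (fun t => c t k i)).
    by apply/funext => t; rewrite mxE fct_sumE.
  rewrite derive1E (derive_mx dc) mxE.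
  under [X in is_derive _ _ _ X]eq_bigr do rewrite mxE.
  apply: is_derive_sum => k; apply/is_deriveZ/derivableP.
  exact: (derivable_mxP _ _ _).1.
(* All vectors now lie in the tangent space at [p], so the matrix of [B] is constant in [t]. *)
pose G i j (t : R) := B p (delta_mx 0 i) (delta_mx 0 j).
have dG i j : is_derive (0 : R) 1 (G i j) 0 by exact: is_derive_cst.
have := is_derive_bilinear_combination (dmul v) (dmul w) dG.
have expand (u : E) : u = \sum_j u 0 j *: delta_mx 0 j by exact: row_sum_delta.
have BE x y : B p x y = \sum_i \sum_j x 0 i * y 0 j * G i j 0.
  by rewrite {1}(expand x) {1}(expand y) bilinear_sum.
have cst : \forall t \near (0 : R),
    B p v w = \sum_i \sum_j (v *m c t) 0 i * (w *m c t) 0 j * G i j t.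
  by apply: filterS hc => t /(pw_transport_form v w pB) <-; rewrite BE.
have /near_eq_is_derive/[apply] : \forall t \near (0 : R),
    \sum_i \sum_j (v *m c t) 0 i * (w *m c t) 0 j * G i j t = B p v w.
  by apply: filterS cst => t ->.
move=> /@derive_val; rewrite derive_cst => /esym H.
rewrite -[RHS]H !BE -big_split; apply: eq_bigr => i _.
rewrite -big_split; apply: eq_bigr => j _.
by rewrite /= c0 !mulmx1; ring.
Qed.

End ParallelForms.

(** * Algebra of almost contact metric structures; uniqueness of the characteristic connection *)

Section Connections.
Local Open Scope ring_scope.
Context {R : realType} {m : nat} {M : manifold R m} {g : metric M}.
Local Notation E := 'rV[R]_m.
Implicit Types (s : acm g) (p : M) (u v w : E) (D : connection M).

Lemma metric_scalarl p w : scalar (g p ^~ w).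
Proof. by move=> a u v; exact: metric_linear. Qed.

Lemma metric_scalarr p v : scalar (g p v).
Proof.
move=> a u w.
by rewrite Defs.metric_sym metric_linear !(Defs.metric_sym g p v).
Qed.

Lemma metricNl p v w : g p (- v) w = - g p v w.
Proof.
have g0 : g p 0 w = 0.
  by have := metric_linear g p (-1) 0 0 w; rewrite scaler0 addr0 mulN1r addNr.
by rewrite -scaleN1r -[_ *: v]addr0 metric_linear mulN1r g0 addr0.
Qed.

Lemma metricDl p u v w : g p (u + v) w = g p u w + g p v w.
Proof. by rewrite -{1}[u]scale1r metric_linear mul1r. Qed.

Lemma metricBl p u v w : g p (u - v) w = g p u w - g p v w.
Proof. by rewrite metricDl metricNl. Qed.

Lemma metricZl p a v w : g p (a *: v) w = a * g p v w.
Proof.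
have g0 : g p 0 w = 0 by rewrite -(subrr 0) metricBl subrr.
by rewrite -[_ *: v]addr0 metric_linear g0 addr0.
Qed.

Lemma metricDr p u v w : g p w (u + v) = g p w u + g p w v.
Proof. by rewrite Defs.metric_sym metricDl !(Defs.metric_sym g p w). Qed.

Lemma metricNr p v w : g p w (- v) = - g p w v.
Proof. by rewrite Defs.metric_sym metricNl Defs.metric_sym. Qed.

Lemma metricZr p a v w : g p w (a *: v) = a * g p w v.
Proof. by rewrite Defs.metric_sym metricZl Defs.metric_sym. Qed.

Lemma metric_nondegenerate p v : (forall w, g p v w = 0) -> v = 0.
Proof.
move=> gv0; apply/eqP; apply: contraT => /(metric_posdef g p).
by rewrite gv0 ltxx.
Qed.

(** From phi^2 xi = 0 one gets 0 = phi^3 xi = - phi xi + c xi with c = eta(phi xi). Hence phi xi = c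
    xi and 0 = phi^2 xi = c^2 xi, so c = 0. *)
Lemma phi_xi s p : phi s p (xi s p) = 0.
Proof.
have x2 : phi s p (phi s p (xi s p)) = 0.
  by rewrite phi_sqr eta_xi scale1r addNr.
have e : phi s p (xi s p) = eta s p (phi s p (xi s p)) *: xi s p.
  apply/eqP; rewrite eq_sym -subr_eq0 addrC -phi_sqr x2.
  by rewrite linear0.
move: x2; set c := eta _ _ _ in e; rewrite e linearZ /= e scalerA.
move=> /(congr1 (eta s p)).
rewrite linear0 linearZ /= eta_xi mulr1 => /eqP.
by rewrite mulf_eq0 orbb => /eqP ->; rewrite scale0r.
Qed.

(** Compute phi^3 v both as phi(phi^2 v) and as phi^2(phi v). *)
Lemma eta_phi s p v : eta s p (phi s p v) = 0.
Proof.
have := congr1 (phi s p) (phi_sqr s p v).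
rewrite phi_sqr linearD linearN linearZ /= phi_xi scaler0.
move=> /addrI /(congr1 (eta s p)).
by rewrite linear0 linearZ /= eta_xi mulr1.
Qed.

(** In the compatibility of [g] with [phi], taken at [v] and xi, the left-hand side vanishes because
    phi xi = 0. *)
Lemma metric_xi s p v : g p v (xi s p) = eta s p v.
Proof.
have := phi_metric s p v (xi s p).
rewrite phi_xi eta_xi mulr1 Defs.metric_sym -(linear0 (phi s p)) phi_metric.
rewrite linear0 mul0r subr0 -[in g p 0](subrr 0) metricBl subrr.
by move=> /eqP; rewrite eq_sym subr_eq0 => /eqP.
Qed.

Lemma phi_skew s p v w : g p (phi s p v) w = - g p v (phi s p w).
Proof.
have := phi_metric s p v (phi s p w).
rewrite eta_phi mulr0 subr0 phi_sqr metricDr metricNr => <-.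
by rewrite metricZr metric_xi eta_phi mulr0 addr0 opprK.
Qed.

Lemma dfun_cst p (a : R) v : dfun (fun=> a) p v = 0.
Proof. exact: derive_cst. Qed.

(** The zero field is its own double, so additivity forces the derivative to be 0. *)
Lemma nabla0 D p v X : smooth_field X p -> (forall q, X q = 0) -> D p v X = 0.
Proof.
move=> sX X0; have := conn_additive D v sX sX.
have -> : (fun q => X q + X q) = X by apply/funext => q; rewrite X0 addr0.
by move/eqP; rewrite -subr_eq subrr => /eqP.
Qed.

Lemma nabla_xi s D p v : metric_connection g D ->
  (forall Y, smooth_field Y p -> nabla_endo D (phi s) p v Y = 0) ->
  D p v (xi s) = 0.
Proof.
move=> mD /(_ _ (@xi_smooth _ _ _ _ s p)).
have sxi := @xi_smooth _ _ _ _ s p.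
rewrite /nabla_endo nabla0; [|exact: phi_smooth|by move=> q; exact: phi_xi].
move=> /eqP; rewrite sub0r oppr_eq0 => /eqP phiD.
have etaD : eta s p (D p v (xi s)) = 0.
  have := mD p v _ _ sxi sxi.
  have -> : (fun q => g q (xi s q) (xi s q)) = fun=> 1.
    by apply/funext => q; rewrite metric_xi eta_xi.
  rewrite dfun_cst metric_xi Defs.metric_sym metric_xi => /esym/eqP.
  by rewrite -mulr2n mulrn_eq0 => /eqP.
(* A vector killed by both [phi] and [eta] is 0, since phi^2 = - I + eta (x) xi. *)
have := phi_sqr s p (D p v (xi s)).
rewrite phiD linear0 etaD scale0r addr0.
by move=> /esym/eqP; rewrite oppr_eq0 => /eqP.
Qed.

(** Here eta = g(., xi), and both [g] and xi are parallel. *)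
Lemma nabla_eta s D p v Y : metric_connection g D ->
  (forall Y, smooth_field Y p -> nabla_endo D (phi s) p v Y = 0) ->
  smooth_field Y p -> nabla_form D (eta s) p v Y = 0.
Proof.
move=> mD pD sY; rewrite /nabla_form.
have -> : (fun q => eta s q (Y q)) = fun q => g q (Y q) (xi s q).
  by apply/funext => q; rewrite metric_xi.
rewrite (mD p v _ _ sY (@xi_smooth _ _ _ _ s p)) nabla_xi//.
rewrite metric_xi (Defs.metric_sym g p (Y p)) -(subrr 0) metricBl subrr.
by rewrite addr0 subrr.
Qed.

Lemma parallel_form_metric D : metric_connection g D -> parallel_form D g.
Proof.
move=> mD; split; [exact: metric_scalarl|exact: metric_scalarr|].
by move=> p X Y sX sY; split=> [|v]; [exact: metric_smooth|exact: mD].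
Qed.

Lemma parallel_form_Phi s D : metric_connection g D ->
  (forall p v Y, smooth_field Y p -> nabla_endo D (phi s) p v Y = 0) ->
  parallel_form D (Phi s).
Proof.
move=> mD pD; split.
- by move=> p w; exact: metric_scalarl.
- by move=> p v a u w; rewrite /Phi linearP; exact: metric_scalarr.
move=> p X Y sX sY; have sphiY := phi_smooth s sY; split=> [|v].
  exact: (metric_smooth g sX sphiY).
rewrite (mD p v X (ap (phi s) Y))//; congr (_ + g p _ _).
by apply/eqP; rewrite -subr_eq0; apply/eqP; exact: pD.
Qed.

(* The difference [A] of the two connections is skew in its last two arguments
   because both are metric; with skew torsions this makes it totally skew.
   Here A X Y Z only depends on the vector X p, but a priori on the field Y. *)
Lemma characteristic_connection_unique s D D' :
  characteristic_connection s D -> characteristic_connection s D' ->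
  conn_eq D D'.
Proof.
move=> [mD tD _ pD] [mD' tD' _ pD'] p v Y sY.
(* Taking [A] from an existential keeps it opaque: it unfolds only through [AE]. *)
have [A AE] : exists A, forall X Y' Z : vfield M,
    A X Y' Z = g p (D p (X p) Y' - D' p (X p) Y') (Z p).
  by exists (fun X Y' Z => g p (D p (X p) Y' - D' p (X p) Y') (Z p)).
pose sm (X : vfield M) := smooth_field X p.
have skew X Y' Z : sm X -> sm Y' -> sm Z -> A X Y' Z = - A X Z Y'.
  move=> sX sY' sZ; have := mD p (X p) _ _ sY' sZ.
  rewrite (mD' p (X p) _ _ sY' sZ) !(Defs.metric_sym g p (Y' p)).
  by rewrite !AE !metricBl; lra.
(* The brackets cancel in the difference of the two torsions; combined with [skew], the remaining
   symmetry is a cyclic rotation of the slots. *)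
have cyc X Y' Z : sm X -> sm Y' -> sm Z -> A X Y' Z = A Z X Y'.
  move=> sX sY' sZ; have [_] := tD p _ _ _ sY' sX sZ.
  have [_] := tD' p _ _ _ sY' sX sZ.
  have := skew _ _ _ sY' sX sZ; have := skew _ _ _ sZ sY' sX.
  rewrite !AE /torsion.
  set b := bracket Y' X p; set c := bracket Y' Z p; move: b c => b c.
  by rewrite !metricBl; lra.
have phiA X Y' Z : sm X -> sm Y' -> sm Z ->
    A X (ap (phi s) Y') Z = - A X Y' (ap (phi s) Z).
  move=> sX sY' sZ; rewrite !AE -phi_skew linearB.
  have /eqP := pD p (X p) Y' sY'; rewrite subr_eq0 => /eqP ->.
  by have /eqP := pD' p (X p) Y' sY'; rewrite subr_eq0 => /eqP ->.
have sphi X : sm X -> sm (ap (phi s) X) by exact: phi_smooth.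
have sxi : sm (xi s) by exact: xi_smooth.
(* Rotating [phiA] by [cyc] gives [e12] and [e13]; together with [phiA] itself they equate the value
   with its opposite. *)
have A_phi X Y' Z : sm X -> sm Y' -> sm Z -> A (ap (phi s) X) Y' Z = 0.
  move=> sX sY' sZ.
  have e12 : A (ap (phi s) X) Y' Z = - A X (ap (phi s) Y') Z.
    rewrite (cyc _ _ _ (sphi _ sX) sY' sZ) (phiA _ _ _ sZ sX sY').
    by rewrite (cyc _ _ _ sX (sphi _ sY') sZ).
  have e13 : A (ap (phi s) X) Y' Z = - A X Y' (ap (phi s) Z).
    rewrite (cyc _ _ _ (sphi _ sX) sY' sZ) (cyc _ _ _ sZ (sphi _ sX) sY').
    rewrite (cyc _ _ _ sX sY' (sphi _ sZ)) (cyc _ _ _ (sphi _ sZ) sX sY').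
    by rewrite (phiA _ _ _ sY' sZ sX) opprK.
  have := phiA X Y' Z sX sY' sZ; lra.
(* Rotation moves xi into the differentiated slot, where both connections give 0. *)
have A_xi Y' Z : sm Y' -> sm Z -> A (xi s) Y' Z = 0.
  move=> sY' sZ; rewrite cyc// AE (nabla_xi mD (pD _ _)).
  by rewrite (nabla_xi mD' (pD' _ _)) metricBl subrr.
apply/eqP; rewrite -subr_eq0; apply/eqP/(@metric_nondegenerate p) => w.
have [Z sZ <-] := exists_smooth_field p w.
(* The choice - phi v is made because phi(- phi v) = v - eta(v) xi: thus [v] splits into a multiple
   of xi and an element of the image of [phi]. *)
have [X sX Xv] := exists_smooth_field p (- phi s p v).
have -> : v = eta s p v *: xi s p + phi s p (X p).
  by rewrite Xv linearN phi_sqr opprD opprK addrCA subrr addr0.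
rewrite !conn_linear// opprD addrACA -scalerBr metricDl metricZl.
have := A_xi _ _ sY sZ; have := A_phi _ _ _ sX sY sZ.
by rewrite !AE /ap => -> ->; rewrite mulr0 addr0.
Qed.

End Connections.

(** * Holonomy algebra of a metric connection with parallel phi *)

Section ParallelStructures.
Local Open Scope ring_scope.
Context {R : realType} {m : nat} {M : manifold R m} {g : metric M}.
Implicit Types (s : acm g) (p : M) (D : connection M).

Lemma holonomy_algebra_skew D p A v w : metric_connection g D ->
  holonomy_algebra D p A -> g p (v *m A) w = - g p v (w *m A).
Proof.
move=> /parallel_form_metric pg hA; apply/eqP; rewrite -addr_eq0; apply/eqP.
exact: holonomy_algebra_form pg hA.
Qed.

(** Invariance of [Phi] and skewness of [A] make phi(v A) - (phi v) A orthogonal to every [w]. *)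
Lemma holonomy_algebra_phi s D p A v : metric_connection g D ->
  (forall p v Y, smooth_field Y p -> nabla_endo D (phi s) p v Y = 0) ->
  holonomy_algebra D p A -> phi s p (v *m A) = phi s p v *m A.
Proof.
move=> mD pD hA; apply/eqP; rewrite -subr_eq0; apply/eqP.
apply: (@metric_nondegenerate _ _ _ g p) => w; rewrite metricBl.
have := holonomy_algebra_form w v (parallel_form_Phi mD pD) hA.
rewrite /Phi (holonomy_algebra_skew _ _ mD hA).
by rewrite !(Defs.metric_sym g p w) addrC.
Qed.

Lemma holonomy_algebra_xi s D p A : metric_connection g D ->
  (forall p v Y, smooth_field Y p -> nabla_endo D (phi s) p v Y = 0) ->
  holonomy_algebra D p A -> xi s p *m A = 0.
Proof.
move=> mD pD hA.
have phiA : phi s p (xi s p *m A) = 0.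
  by rewrite (holonomy_algebra_phi _ mD pD hA) phi_xi mul0mx.
have etaA : eta s p (xi s p *m A) = 0.
  have := holonomy_algebra_skew (xi s p) (xi s p) mD hA.
  rewrite metric_xi Defs.metric_sym metric_xi => /eqP.
  by rewrite -addr_eq0 -mulr2n mulrn_eq0 => /eqP.
have := phi_sqr s p (xi s p *m A).
rewrite phiA linear0 etaA scale0r addr0.
by move=> /esym/eqP; rewrite oppr_eq0 => /eqP.
Qed.

(** By skewness, eta(v A) = g(v A, xi) = - g(v, xi A), and xi A = 0. *)
Lemma holonomy_algebra_eta s D p A v : metric_connection g D ->
  (forall p v Y, smooth_field Y p -> nabla_endo D (phi s) p v Y = 0) ->
  holonomy_algebra D p A -> eta s p (v *m A) = 0.
Proof.
move=> mD pD hA; rewrite -metric_xi (holonomy_algebra_skew _ _ mD hA).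
rewrite (holonomy_algebra_xi mD pD hA) Defs.metric_sym.
by rewrite -(subrr 0) metricBl subrr oppr0.
Qed.

End ParallelStructures.

Theorem corollary4p1p2 (R : realType) (n : nat) (hn : (1 <= n)%N)
    (M : manifold R (4 * n + 3)) (g : metric M) (S : acm3 g) (beta : M -> R)
    (hS : parallel_canonical S beta)
    (D : connection M) (hD : canonical_connection S beta D) :
  (forall i : 'Z_3,
     characteristic_connection (S i) D /\
     forall Di : connection M,
       characteristic_connection (S i) Di -> conn_eq Di D) /\
  (forall p : M, (holonomy_algebra D p `<=` sp S p)%classic).
Proof.
have [_ beta0] := hS; have [mD tD cD] := hD.
(* Since beta = 0, the equation defining the canonical connection reads nabla phi_i = 0. *)
have pD i p v Y : smooth_field Y p -> nabla_endo D (phi (S i)) p v Y = 0%R.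
  by move=> sY; rewrite cD// beta0 scale0r.
split=> [i|p A hA].
  have chD : characteristic_connection (S i) D.
    split=> // p v Y sY; first by apply: nabla_eta => // Z; exact: pD.
    exact: pD.
  by split=> // Di chDi; exact: characteristic_connection_unique chDi chD.
(* These are the four clauses of [sp]; stability of the horizontal space holds because eta_i(v A) =
   0 for every [i]. *)
split=> [v w|i|v _ i|i v _].
- exact: holonomy_algebra_skew mD hA.
- exact: holonomy_algebra_xi mD (pD i) hA.
- exact: holonomy_algebra_eta mD (pD i) hA.
- exact: holonomy_algebra_phi mD (pD i) hA.
Qed.
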